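(* Let the set of agents $\{1,\dots,n\}$, $n\ge 1$, be partitioned into $p\ge 1$ pairwise disjoint nonempty groups, the $j$-th group having $n_j\ge 1$ agents, and let $\chi(i)$ denote the group to which agent $i$ belongs. Let $A_H\in\mathbb{R}^{n\times p}$ be the matrix with entries $(A_H)_{ij}=1$ if agent $i$ belongs to group $j$ and $0$ otherwise. Let $(H,E_H)$ be a simple graph whose vertices are the $p$ groups, with $q$ edges each given a reference direction, let $A_G\in\mathbb{R}^{p\times q}$ be its incidence matrix, and set $\mathbb{G}=A_GA_G^{\mathsf T}$. Consider the system $$x'=-x+A_H(A_H^{\mathsf T}A_H)^{-1}y,\qquad y'=A_H^{\mathsf T}x-(\mathbb{I}_p+\mathbb{G})y,$$ with $x\in\mathbb{R}^n$, $y\in\mathbb{R}^p$ and $\mathbb{I}_p$ the identity matrix of order $p$. Assume that the graph $(H,E_H)$ is connected. Then: (a) The system has a line of equilibria defined by the relations $$x_i=\frac{y_{\chi(i)}}{n_{\chi(i)}}\ (i=1,\dots,n),\qquad y_1=y_2=\dots=y_p.$$ (b) The solution with initial condition $(x(0),y(0))$ converges exponentially (as $t\to\infty$) to the equilibrium defined by $$x_i=\frac{y_{\chi(i)}}{n_{\chi(i)}},\ i=1,\dots,n,\qquad y_j=\frac{1}{2p}\left(\sum_{i=1}^n x_i(0)+\sum_{k=1}^p y_k(0)\right),\ j=1,\dots,p.$$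
   Context: A graph is simple if it has neither parallel edges nor self-loops. The incidence matrix $A_G=(a_{ij})\in\mathbb{R}^{p\times q}$ of the directed graph $(H,E_H)$ has $a_{ij}=1$ if edge $j$ leaves group $i$, $a_{ij}=-1$ if edge $j$ enters group $i$, and $a_{ij}=0$ if edge $j$ is not incident with group $i$; thus $\mathbb{G}$ is the graph Laplacian matrix of $(H,E_H)$. The matrix $A_H^{\mathsf T}A_H$ is diagonal of order $p$ with $j$-th diagonal entry $n_j$. *)

(* Defs.v *)
From mathcomp Require Import all_boot all_order all_algebra.
From mathcomp Require Import all_classical all_reals all_analysis.

Set Implicit Arguments.
Unset Strict Implicit.
Unset Printing Implicit Defensive.

Import Order.TTheory GRing.Theory Num.Theory.
Import numFieldNormedType.Exports.

Local Open Scope classical_set_scope.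
Local Open Scope ring_scope.

(* A partition of the agents 'I_n into groups indexed by 'I_p is given by the
   map chi sending an agent to its group; disjointness and covering are then
   automatic, and nonemptiness of the groups is a hypothesis on chi. *)
Definition group n p (chi : 'I_n -> 'I_p) (j : 'I_p) : {set 'I_n} :=
  [set i | chi i == j]%SET.

Definition group_size n p (chi : 'I_n -> 'I_p) (j : 'I_p) : nat :=
  #|group chi j|.

(* A graph on 'I_p with edges 'I_q: the reference direction of edge j goes from
   tail j to head j.  Two edges are parallel when they join the same unordered
   pair of vertices, whatever their reference directions. *)
Definition simple_graph p q (tail head : 'I_q -> 'I_p) : Prop :=
  (forall j, tail j != head j) /\
  (forall j k, [set tail j; head j]%SET = [set tail k; head k]%SET -> j = k).

Definition adjacent p q (tail head : 'I_q -> 'I_p) : rel 'I_p :=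
  fun u v => [exists j, ((tail j == u) && (head j == v)) ||
                        ((tail j == v) && (head j == u))].

Definition connected_graph p q (tail head : 'I_q -> 'I_p) : Prop :=
  forall u v, connect (adjacent tail head) u v.

Section Systems.
Variable R : realType.

Definition incidence_mx p q (tail head : 'I_q -> 'I_p) : 'M[R]_(p, q) :=
  \matrix_(i, j) (if tail j == i then 1 else if head j == i then -1 else 0).

Definition laplacian_mx p q (tail head : 'I_q -> 'I_p) : 'M[R]_p :=
  incidence_mx tail head *m (incidence_mx tail head)^T.

Definition membership_mx n p (chi : 'I_n -> 'I_p) : 'M[R]_(n, p) :=
  \matrix_(i, j) (if i \in group chi j then 1 else 0).

Definition field_x n p (chi : 'I_n -> 'I_p)
    (x : 'cV[R]_n) (y : 'cV[R]_p) : 'cV[R]_n :=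
  let AH := membership_mx chi in
  - x + AH *m invmx (AH^T *m AH) *m y.

Definition field_y n p q (chi : 'I_n -> 'I_p) (tail head : 'I_q -> 'I_p)
    (x : 'cV[R]_n) (y : 'cV[R]_p) : 'cV[R]_p :=
  (membership_mx chi)^T *m x - (1%:M + laplacian_mx tail head) *m y.

Definition equilibria n p q (chi : 'I_n -> 'I_p) (tail head : 'I_q -> 'I_p) :
    set ('cV[R]_n * 'cV[R]_p) :=
  [set z | field_x chi z.1 z.2 = 0 /\ field_y chi tail head z.1 z.2 = 0].

(* Solutions live on [0, +oo[: the values of x and y at negative times are
   irrelevant, and the initial values are attained by continuity. *)
Definition is_solution n p q (chi : 'I_n -> 'I_p) (tail head : 'I_q -> 'I_p)
    (x : R -> 'cV[R]_n) (y : R -> 'cV[R]_p) : Prop :=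
  [/\ {within `[0, +oo[, continuous x},
      {within `[0, +oo[, continuous y} &
      forall t : R, 0 < t ->
        is_derive t 1 x (field_x chi (x t) (y t)) /\
        is_derive t 1 y (field_y chi tail head (x t) (y t))].

Definition is_line (V : lmodType R) (S : set V) : Prop :=
  exists a v : V, v != 0 /\ S = [set a + c *: v | c in [set: R]].

Definition cvg_exponentially (V : normedModType R) (z : R -> V) (l : V) :
    Prop :=
  exists M lambda : R, 0 < lambda /\
    forall t : R, 0 <= t -> `|z t - l| <= M * expR (- (lambda * t)).

Definition limit_y n p (x0 : 'cV[R]_n) (y0 : 'cV[R]_p) : 'cV[R]_p :=
  \col_j ((2 * p%:R)^-1 * (\sum_i x0 i ord0 + \sum_k y0 k ord0)).

Definition limit_x n p (chi : 'I_n -> 'I_p) (x0 : 'cV[R]_n) (y0 : 'cV[R]_p) :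
    'cV[R]_n :=
  \col_i (limit_y x0 y0 (chi i) ord0 / (group_size chi (chi i))%:R).

End Systems.

Arguments equilibria R {n p q} chi tail head.

(* Main.v *)
Require Import Defs.
From mathcomp Require Import all_boot all_order all_algebra.
From mathcomp Require Import all_classical all_reals all_analysis.
From mathcomp Require Import ring lra.

Set Implicit Arguments.
Unset Strict Implicit.
Unset Printing Implicit Defensive.

Import Order.TTheory GRing.Theory Num.Theory.
Import numFieldNormedType.Exports.
Local Open Scope classical_set_scope.
Local Open Scope ring_scope.

(** Read the pair (x, y) as a mass distribution over agents and groups: the
system moves mass linearly and conserves its [total].  Weighting the square of
[x_i] by the size of the group of [i] turns the matrix of the system into a
symmetric one, negative semidefinite: [energy_balance] shows that the weighted
inner product of a state with its velocity is minus [dissipation], a sum of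
squares of the defects [x_i - y_chi(i) / n_chi(i)] and of the differences of [y]
along the edges.

When the graph is connected, the dissipation vanishes only if [y] is constant
and every defect is zero, which identifies the equilibria.  For states of
total zero it even bounds the energy up to a constant: differences of [y] are sums
of edge differences along a path, and the vanishing total then recovers each
[y_k] from these differences and the defects.  This is [energy_gap], a Poincare
inequality.

The limit in the statement is the equilibrium with the same total as the initial
state, so that the difference between a solution and its limit is a solution of
total zero.  Its energy satisfies [E' = - 2 dissipation <= - (2 / C) E], hence
decays exponentially ([expR_decay]), and the energy controls the norm.

Solutions exist because the entries of [exp (t M) z0] are everywhere convergent
power series in [t] ([linear_equation_solution]). *)

(** * Derivatives of finite families *)

Lemma is_derive_cV (R : realType) (m : nat) (z : R -> 'cV[R]_m) (v : 'cV[R]_m)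
    (t : R) :
  is_derive t 1 z v <->
  forall i, is_derive t 1 (fun s => z s i ord0) (v i ord0).
Proof.
split=> [[dz zv] i|dz].
  split; first exact: (derivable_mxP _ _ _).1 dz i ord0.
  by rewrite -zv derive_mx// mxE.
have zD : derivable z t 1.
  by apply/derivable_mxP => i j; rewrite (ord1 j); case: (dz i).
split=> //; apply/colP => i; rewrite derive_mx// mxE.
by case: (dz i).
Qed.

Lemma is_derive_sum_fun (R : realType) (m : nat) (f : 'I_m -> R -> R)
    (df : 'I_m -> R) (t : R) :
  (forall i, is_derive t 1 (f i) (df i)) ->
  is_derive t 1 (fun s => \sum_i f i s) (\sum_i df i).
Proof.
move=> fdf; rewrite (_ : (fun s => _) = \sum_i f i); first exact: is_derive_sum.
by apply/funext => s; rewrite fct_sumE.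
Qed.

Lemma is_derive_weighted_sqr (R : realType) (m : nat) (a : 'I_m -> R)
    (f : 'I_m -> R -> R) (df : 'I_m -> R) (t : R) :
  (forall i, is_derive t 1 (f i) (df i)) ->
  is_derive t 1 (fun s => \sum_i a i * f i s ^+ 2)
    (2 * \sum_i a i * f i t * df i).
Proof.
move=> fdf; rewrite mulr_sumr; apply: is_derive_sum_fun => i.
have fi := fdf i.
rewrite (_ : (fun s => _) = a i \*: (f i ^+ 2)).
  by apply: is_derive_eq; rewrite /GRing.scale/=; ring.
by apply/funext => s; rewrite exprfctE.
Qed.

(** * Linear differential equations *)

Section LinearEquation.
Variables (R : realType) (m : nat) (M : 'M[R]_m).

(** The coefficient of [t ^ k] in the [i]-th entry of [exp (t M) z]. *)
Definition exp_entry_coef (z : 'cV[R]_m) (i : 'I_m) (k : nat) : R :=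
  iter k (mulmx M) z i ord0 / k`!%:R.

(** The sum of all [`|M i j|] dominates the operator norm of [M] for the
    sup norm; it is crude, but any geometric bound makes the exponential series
    converge. *)
Lemma iter_mulmx_bound (z : 'cV[R]_m) (k : nat) (i : 'I_m) :
  `|iter k (mulmx M) z i ord0| <=
  (\sum_i \sum_j `|M i j|) ^+ k * \sum_j `|z j ord0|.
Proof.
elim: k i => [|k IH] i.
  by rewrite expr0 mul1r /= (bigD1 i)//= lerDl sumr_ge0.
rewrite iterS mxE (le_trans (ler_norm_sum _ _ _))//.
rewrite exprS -mulrA.
apply: (@le_trans _ _ (\sum_j `|M i j| *
    ((\sum_i \sum_j `|M i j|) ^+ k * \sum_j `|z j ord0|))).
  by apply: ler_sum => j _; rewrite normrM ler_wpM2l.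
rewrite -mulr_suml; apply: ler_wpM2r.
  rewrite mulr_ge0 ?sumr_ge0// exprn_ge0// sumr_ge0// => ? _.
  exact: sumr_ge0.
rewrite [leRHS](bigD1 i)//= lerDl sumr_ge0// => ? _; exact: sumr_ge0.
Qed.

Lemma cvg_exp_pseries (z : 'cV[R]_m) (i : 'I_m) (x : R) :
  cvgn (pseries (exp_entry_coef z i) x).
Proof.
set K : R := \sum_i \sum_j `|M i j|; set B : R := \sum_j `|z j ord0|.
have K0 : 0 <= K by apply: sumr_ge0 => ? _; exact: sumr_ge0.
have B0 : 0 <= B by exact: sumr_ge0.
apply: normed_cvg.
have BE k : (B *: exp_coeff (K * `|x|)) k = B * exp_coeff (K * `|x|) k by [].
apply: (@series_le_cvg _ _ (B *: exp_coeff (K * `|x|))) => [k|k|k|].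
- by rewrite /= normr_ge0.
- by rewrite BE mulr_ge0// exp_coeff_ge0// mulr_ge0.
- rewrite BE /exp_entry_coef /exp_coeff/= !normrM normrX normfV.
  rewrite [`|k`!%:R|]ger0_norm ?ler0n// exprMn.
  rewrite (_ : B * _ = (K ^+ k * B) / k`!%:R * `|x| ^+ k); last by ring.
  rewrite ler_wpM2r ?exprn_ge0// ler_wpM2r ?invr_ge0 ?ler0n//.
  exact: iter_mulmx_bound.
- apply: is_cvg_seriesZ; exact: is_cvg_series_exp_coeff.
Qed.

(** Formal differentiation of the series only changes the initial vector, so the
    three convergence conditions of term-by-term differentiation are instances
    of [cvg_exp_pseries]. *)
Lemma pseries_diffs_exp_entry_coef (z : 'cV[R]_m) (i : 'I_m) :
  pseries_diffs (exp_entry_coef z i) = exp_entry_coef (M *m z) i.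
Proof.
apply/funext => k; rewrite /pseries_diffs /exp_entry_coef iterSr.
rewrite factS natrM invfM.
have k1 : k.+1%:R != 0 :> R by rewrite pnatr_eq0.
by rewrite mulrCA mulVKf.
Qed.

Lemma lim_exp_pseries_mulmx (z : 'cV[R]_m) (i : 'I_m) (x : R) :
  limn (pseries (exp_entry_coef (M *m z) i) x) =
  \sum_j M i j * limn (pseries (exp_entry_coef z j) x).
Proof.
apply: cvg_lim => //.
rewrite (_ : pseries _ _ =
    fun N => \sum_j M i j * pseries (exp_entry_coef z j) x N); last first.
  apply/funext => N; rewrite /pseries /series/=.
  under [RHS]eq_bigr do rewrite mulr_sumr.
  rewrite exchange_big/=; apply: eq_bigr => k _.
  rewrite /exp_entry_coef -iterSr iterS mxE !mulr_suml.
  by apply: eq_bigr => j _; rewrite !mulrA.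
apply: cvg_big => [|j _]; first exact: add_continuous.
by apply: cvgMr; exact: cvg_exp_pseries.
Qed.

(** The entries of [exp (t M) z0] are power series in [t]; differentiating them
    term by term replaces [z0] by [M z0]. *)
Lemma linear_equation_solution (z0 : 'cV[R]_m) :
  exists z : R -> 'cV[R]_m,
    z 0 = z0 /\ forall t : R, is_derive t 1 z (M *m z t).
Proof.
exists (fun t => \col_i limn (pseries (exp_entry_coef z0 i) t)); split.
  apply/colP => i; rewrite mxE; apply: cvg_lim => //.
  apply: cvg_near_cst; exists 1%N => // -[//|N] _.
  rewrite /pseries /series/= big_nat_recl//= big1 ?addr0 => [|k _].
    by rewrite /exp_entry_coef/= fact0 divr1 mulr1.
  by rewrite expr0n mulr0.
move=> t; apply/is_derive_cV => i; rewrite mxE.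
rewrite (_ : (fun s => _) =
    fun s => limn (pseries (exp_entry_coef z0 i) s)); last first.
  by apply/funext => s; rewrite mxE.
under eq_bigr do rewrite mxE.
rewrite -lim_exp_pseries_mulmx -pseries_diffs_exp_entry_coef.
apply: (@pseries_snd_diffs _ _ (`|t| + 1));
  rewrite ?pseries_diffs_exp_entry_coef; try exact: cvg_exp_pseries.
by rewrite [ltRHS]ger0_norm ?ltrDl// addr_ge0.
Qed.

End LinearEquation.

(** * Differential inequalities on the half-line *)

(** The product of [u] and [expR (k t)] is nonincreasing. *)
Lemma expR_decay (R : realType) (u du : R -> R) (k : R) :
  {within `[0, +oo[, continuous u} ->
  (forall t : R, 0 < t -> is_derive t 1 u (du t)) ->
  (forall t, 0 < t -> du t <= - k * u t) ->
  forall t, 0 <= t -> u t <= u 0 * expR (- (k * t)).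
Proof.
move=> cu udu du_le t t0.
pose e := fun s : R => expR (k * s).
have ede (s : R) : is_derive s 1 e (k * e s).
  rewrite mulrC; apply: (@is_derive1_comp _ expR ( *%R k)).
  rewrite -[X in is_derive _ _ _ X]mulr1.
  exact: (is_deriveZ k (is_derive_id _ _)).
have uede (s : R) : 0 < s -> is_derive s 1 (u * e) (e s * (du s + k * u s)).
  move=> s0; have us := udu s s0.
  by apply: is_derive_eq; rewrite /GRing.scale/=; ring.
have cue : {within `[0, +oo[, continuous (u * e)}.
  move=> s; apply: cvgM; first exact: cu.
  apply: continuous_subspaceT => r; apply: differentiable_continuous.
  by apply/derivable1_diffP; case: (ede r).
have : (u * e) t <= (u * e) 0.
  apply: (@ler0_derive1_nincry _ _ 0) => // s; rewrite in_itv/= andbT => s0.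
    by case: (uede s s0).
  rewrite derive1E; case: (uede s s0) => _ ->.
  by rewrite pmulr_rle0 ?expR_gt0// -lerBrDr sub0r -mulNr du_le.
rewrite /GRing.mul/= /e mulr0 expR0 mulr1 => uete.
by rewrite expRN ler_pdivlMr ?expR_gt0.
Qed.

Lemma is_derive0_constant (R : realType) (u : R -> R) :
  {within `[0, +oo[, continuous u} ->
  (forall t : R, 0 < t -> is_derive t 1 u 0) ->
  forall t, 0 <= t -> u t = u 0.
Proof.
move=> cu u0 t t0.
have H (v : R -> R) : {within `[0, +oo[, continuous v} ->
    (forall t : R, 0 < t -> is_derive t 1 v 0) -> v t <= v 0.
  move=> cv v0; have := @expR_decay _ v (fun=> 0) 0 cv v0 _ t t0.
  by rewrite mul0r oppr0 expR0 mulr1; apply => s _; rewrite mul0r.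
apply/le_anti/andP; split; first exact: H.
rewrite -lerN2; apply: (H (- u)) => [s|s s0]; first exact/continuousN/cu.
by rewrite -oppr0; apply: is_deriveN; exact: u0.
Qed.

(** * Quadratic domination *)

Section Domination.
Variables (R : realType) (T : Type) (D : set T) (Q : T -> R).

(** Working with existence of a constant, instead of explicit constants, leaves
    the Poincare inequality below as a matter of closure under sums. *)
Definition dominated (f : T -> R) : Prop :=
  exists2 C : R, 0 <= C & forall z, D z -> f z <= C * Q z.

Lemma dominated_le (f g : T -> R) :
  (forall z, D z -> f z <= g z) -> dominated g -> dominated f.
Proof.
by move=> fg [C C0 gC]; exists C => // z Dz; rewrite (le_trans (fg z Dz)) ?gC.
Qed.

Lemma dominated_sum (m : nat) (a : 'I_m -> R) (f : 'I_m -> T -> R) :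
  (forall i, 0 <= a i) -> (forall i, dominated (f i)) ->
  dominated (fun z => \sum_i a i * f i z).
Proof.
move=> a0 fQ; pose C i := s2val (cid2 (fQ i)).
exists (\sum_i a i * C i) => [|z Dz].
  by apply: sumr_ge0 => i _; rewrite mulr_ge0// /C; case: cid2.
rewrite mulr_suml; apply: ler_sum => i _.
rewrite -mulrA ler_wpM2l// /C; case: cid2 => /= c _; exact.
Qed.

Lemma dominated_sqrD (f g : T -> R) :
  dominated (fun z => f z ^+ 2) -> dominated (fun z => g z ^+ 2) ->
  dominated (fun z => (f z + g z) ^+ 2).
Proof.
move=> [C C0 fC] [E E0 gE]; exists (2 * C + 2 * E) => [|z Dz].
  by rewrite addr_ge0// mulr_ge0.
have := fC z Dz; have := gE z Dz; have := sqr_ge0 (f z - g z); nra.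
Qed.

Lemma dominated_sqrZ (a : R) (f : T -> R) :
  dominated (fun z => f z ^+ 2) -> dominated (fun z => (a * f z) ^+ 2).
Proof.
move=> [C C0 fC]; exists (a ^+ 2 * C) => [|z Dz].
  by rewrite mulr_ge0 ?sqr_ge0.
by rewrite exprMn -mulrA ler_wpM2l ?sqr_ge0 ?fC.
Qed.

Lemma dominated_sqr_sum (m : nat) (f : 'I_m -> T -> R) :
  (forall i, dominated (fun z => f i z ^+ 2)) ->
  dominated (fun z => (\sum_i f i z) ^+ 2).
Proof.
elim: m f => [|m IH] f fQ.
  by exists 0 => // z _; rewrite big_ord0 expr0n mul0r.
rewrite (_ : (fun z => _) =
    fun z => (f ord0 z + \sum_(i < m) f (lift ord0 i) z) ^+ 2); last first.
  by apply/funext => z; rewrite big_ord_recl.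
by apply: dominated_sqrD => //; apply: IH => i; exact: fQ.
Qed.

End Domination.

(** * The vector field *)

Section Network.
Variables (R : realType) (n p q : nat).
Variables (chi : 'I_n -> 'I_p) (tail head : 'I_q -> 'I_p).
Hypothesis group_nonempty : forall j : 'I_p, group chi j != finset.set0.
Hypothesis loopless : forall e : 'I_q, tail e != head e.

Local Notation gs j := ((group_size chi j)%:R : R).
Local Notation AH := (membership_mx R chi).
Local Notation AG := (incidence_mx R tail head).

Definition total (x : 'cV[R]_n) (y : 'cV[R]_p) : R :=
  \sum_i x i ord0 + \sum_j y j ord0.

Definition energy (x : 'cV[R]_n) (y : 'cV[R]_p) : R :=
  \sum_i gs (chi i) * x i ord0 ^+ 2 + \sum_j y j ord0 ^+ 2.

(** The mass of agent [i] minus its share of the mass of its group: the velocity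
    of [x_i] is the opposite of this defect. *)
Definition group_defect (x : 'cV[R]_n) (y : 'cV[R]_p) (i : 'I_n) : R :=
  x i ord0 - y (chi i) ord0 / gs (chi i).

Definition dissipation (x : 'cV[R]_n) (y : 'cV[R]_p) : R :=
  \sum_i gs (chi i) * group_defect x y i ^+ 2 +
  \sum_e (y (tail e) ord0 - y (head e) ord0) ^+ 2.

Lemma group_size_ge1 (j : 'I_p) : 1 <= gs j.
Proof. by rewrite ler1n card_gt0. Qed.

Lemma group_size_gt0 (j : 'I_p) : 0 < gs j.
Proof. exact: lt_le_trans ltr01 (group_size_ge1 j). Qed.

Lemma group_size_neq0 (j : 'I_p) : gs j != 0.
Proof. by rewrite gt_eqF ?group_size_gt0. Qed.

Lemma sum_by_group (f : 'I_p -> R) (x : 'I_n -> R) :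
  \sum_i f (chi i) * x i = \sum_j f j * \sum_(i in group chi j) x i.
Proof.
rewrite (partition_big chi xpredT)//=; apply: eq_bigr => j _.
rewrite mulr_sumr; apply: eq_big => [i|i /eqP -> //].
by rewrite inE.
Qed.

Lemma sum_group_average (f : 'I_p -> R) :
  \sum_i f (chi i) / gs (chi i) = \sum_j f j.
Proof.
rewrite (sum_by_group f (fun i => (gs (chi i))^-1)); apply: eq_bigr => j _.
rewrite (eq_bigr (fun=> (gs j)^-1)) => [|i]; last by rewrite inE => /eqP ->.
by rewrite sumr_const -[_ *+ _]mulr_natl divff ?mulr1 ?group_size_neq0.
Qed.

Lemma membership_gram : AH^T *m AH = diag_mx (\row_j gs j).
Proof.
apply/matrixP => j k; rewrite !mxE.
under eq_bigr do rewrite !mxE !inE.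
have [->|jk] := eqVneq j k.
  rewrite mulr1n /group_size -sum1_card natr_sum [RHS]big_mkcond/=.
  by apply: eq_bigr => i _; rewrite inE; case: ifP; rewrite ?mulr1 ?mulr0.
rewrite mulr0n big1// => i _.
case: eqP => [->|_]; last by rewrite mul0r.
by rewrite (negPf jk) mulr0.
Qed.

Lemma invmx_gram : invmx (AH^T *m AH) = diag_mx (\row_j (gs j)^-1).
Proof.
have GV : AH^T *m AH *m diag_mx (\row_j (gs j)^-1) = 1%:M.
  rewrite membership_gram; apply/matrixP => j k.
  rewrite mul_diag_mx !mxE; case: eqP => [->|_]; last by rewrite mulr0n mulr0.
  by rewrite mulr1n divff// group_size_neq0.
have [uG _] := mulmx1_unit GV.
by rewrite -[invmx _]mulmx1 -GV mulmxA mulVmx// mul1mx.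
Qed.

Lemma field_xE (x : 'cV[R]_n) (y : 'cV[R]_p) (i : 'I_n) :
  field_x chi x y i ord0 = - x i ord0 + y (chi i) ord0 / gs (chi i).
Proof.
rewrite /field_x invmx_gram -mulmxA mul_diag_mx !mxE; congr (_ + _).
rewrite (bigD1 (chi i))//= big1 => [|j ji]; last first.
  by rewrite !mxE inE eq_sym (negPf ji) mul0r.
by rewrite !mxE inE eqxx mul1r addr0 mulrC.
Qed.

Lemma field_yE (x : 'cV[R]_n) (y : 'cV[R]_p) (j : 'I_p) :
  field_y chi tail head x y j ord0 =
  \sum_(i in group chi j) x i ord0 - y j ord0
  - (laplacian_mx R tail head *m y) j ord0.
Proof.
rewrite /field_y mulmxDl mul1mx opprD addrA 2!mxE.
rewrite [X in _ + X]mxE; congr (_ + _).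
rewrite [X in _ + X]mxE; congr (_ + _).
rewrite mxE [RHS]big_mkcond/=; apply: eq_bigr => i _; rewrite !mxE.
by case: ifP; rewrite ?mul1r ?mul0r.
Qed.

Lemma incidence_trE (y : 'cV[R]_p) (e : 'I_q) :
  (AG^T *m y) e ord0 = y (tail e) ord0 - y (head e) ord0.
Proof.
rewrite mxE (bigD1 (tail e))//= (bigD1 (head e))/=; last first.
  by rewrite eq_sym loopless.
rewrite big1 => [|j /andP[jt jh]]; last first.
  by rewrite !mxE ![_ == j]eq_sym (negPf jt) (negPf jh) mul0r.
by rewrite !mxE eqxx (negPf (loopless e)) eqxx addr0 mul1r mulN1r.
Qed.

(** Summation by parts on the graph.  With [u = y] it gives the edge part of the
    dissipation, and with [u] constant the conservation of the total. *)
Lemma laplacian_form (u y : 'cV[R]_p) :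
  \sum_j u j ord0 * (laplacian_mx R tail head *m y) j ord0 =
  \sum_e (u (tail e) ord0 - u (head e) ord0) *
         (y (tail e) ord0 - y (head e) ord0).
Proof.
under [RHS]eq_bigr do rewrite -!incidence_trE.
have -> : \sum_j u j ord0 * (laplacian_mx R tail head *m y) j ord0 =
    (u^T *m (laplacian_mx R tail head *m y)) ord0 ord0.
  by rewrite [RHS]mxE; apply: eq_bigr => j _; rewrite [u^T _ _]mxE.
rewrite /laplacian_mx -mulmxA mulmxA -{1}[AG]trmxK -trmx_mul mxE.
by apply: eq_bigr => e _; rewrite [_^T _ _]mxE.
Qed.

(** Every exchange between an agent and its group, and between two adjacent
    groups, takes from one end what it gives to the other. *)
Lemma total_field (x : 'cV[R]_n) (y : 'cV[R]_p) :
  total (field_x chi x y) (field_y chi tail head x y) = 0.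
Proof.
rewrite /total.
under eq_bigr do rewrite field_xE.
under [X in _ + X]eq_bigr do rewrite field_yE.
rewrite !big_split/= !sumrN.
rewrite (sum_group_average (fun j => y j ord0)).
have -> : \sum_j \sum_(i in group chi j) x i ord0 = \sum_i x i ord0.
  have := sum_by_group (fun=> 1) (fun i => x i ord0).
  rewrite (eq_bigr (fun i => x i ord0)) => [->|i _]; last by rewrite mul1r.
  by apply: eq_bigr => j _; rewrite mul1r.
have -> : \sum_j (laplacian_mx R tail head *m y) j ord0 = 0.
  have := laplacian_form (const_mx 1) y.
  rewrite [RHS]big1 => [lap1|e _]; last by rewrite !mxE subrr mul0r.
  by rewrite -[RHS]lap1; apply: eq_bigr => j _;
    rewrite [const_mx _ _ _]mxE mul1r.
ring.
Qed.

(** The coupling terms between [x_i] and [y_chi(i)] coincide after weighting by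
    the group size, and [y_j ^ 2] splits into equal shares over the agents of
    group [j]; each agent then contributes a completed square. *)
Lemma energy_balance (x : 'cV[R]_n) (y : 'cV[R]_p) :
  \sum_i gs (chi i) * x i ord0 * field_x chi x y i ord0 +
  \sum_j y j ord0 * field_y chi tail head x y j ord0 = - dissipation x y.
Proof.
have -> : \sum_j y j ord0 * field_y chi tail head x y j ord0 =
    \sum_i (y (chi i) ord0 * x i ord0 - y (chi i) ord0 ^+ 2 / gs (chi i)) -
    \sum_e (y (tail e) ord0 - y (head e) ord0) ^+ 2.
  rewrite sumrB (sum_group_average (fun j => y j ord0 ^+ 2)).
  rewrite (sum_by_group (fun j => y j ord0) (fun i => x i ord0)).
  have := laplacian_form y y.
  under [RHS]eq_bigr do rewrite -expr2.
  move=> <-; rewrite -!sumrB; apply: eq_bigr => j _.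
  by rewrite field_yE; ring.
rewrite addrA -big_split/= /dissipation opprD; congr (_ - _).
rewrite -sumrN.
apply: eq_bigr => i _; rewrite field_xE /group_defect.
have := group_size_neq0 (chi i); move: (gs _) => g g0.
by field.
Qed.

Lemma dissipation_ge0 (x : 'cV[R]_n) (y : 'cV[R]_p) : 0 <= dissipation x y.
Proof.
rewrite addr_ge0// sumr_ge0// => i _; rewrite ?sqr_ge0//.
by rewrite mulr_ge0 ?sqr_ge0// ltW ?group_size_gt0.
Qed.

Lemma group_defect_le_dissipation (x : 'cV[R]_n) (y : 'cV[R]_p) (i : 'I_n) :
  group_defect x y i ^+ 2 <= dissipation x y.
Proof.
rewrite /dissipation (bigD1 i)//= -!addrA.
apply: (@le_trans _ _ (gs (chi i) * group_defect x y i ^+ 2)).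
  by rewrite ler_peMl ?sqr_ge0 ?group_size_ge1.
rewrite lerDl addr_ge0 ?sumr_ge0// => k _; rewrite ?sqr_ge0//.
by rewrite mulr_ge0 ?sqr_ge0// ltW ?group_size_gt0.
Qed.

Lemma edge_defect_le_dissipation (x : 'cV[R]_n) (y : 'cV[R]_p) (e : 'I_q) :
  (y (tail e) ord0 - y (head e) ord0) ^+ 2 <= dissipation x y.
Proof.
rewrite /dissipation (bigD1 e)//= addrCA.
rewrite lerDl addr_ge0 ?sumr_ge0// => k _; rewrite ?sqr_ge0//.
by rewrite mulr_ge0 ?sqr_ge0// ltW ?group_size_gt0.
Qed.

(** * Equilibria and the energy gap *)

Hypothesis connected : connected_graph tail head.

Local Notation state := ('cV[R]_n * 'cV[R]_p)%type.
Local Notation dissipation2 := (fun z : state => dissipation z.1 z.2).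

(** A difference of values of [y] telescopes along a path of the graph, and each
    step is bounded by the dissipation of one edge. *)
Lemma difference_dominated (D : set state) (u v : 'I_p) :
  dominated D dissipation2 (fun z => (z.2 u ord0 - z.2 v ord0) ^+ 2).
Proof.
have /connectP[s] := connected u v.
elim: s u => [|w s IH] u /= => [_ ->|/andP[uw ws] vE].
  by exists 0 => // z _; rewrite subrr expr0n mul0r.
have [C C0 wvC] := IH w ws vE.
apply: (dominated_le (g := fun z : state =>
    ((z.2 u ord0 - z.2 w ord0) + (z.2 w ord0 - z.2 v ord0)) ^+ 2)).
  by move=> z _; rewrite addrA subrK.
apply: dominated_sqrD; last by exists C.
exists 1 => // z _; rewrite mul1r.
have /existsP[e /orP[/andP[/eqP <- /eqP <-]|/andP[/eqP <- /eqP <-]]] := uw.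
  exact: edge_defect_le_dissipation.
by rewrite -sqrrN opprB edge_defect_le_dissipation.
Qed.

Lemma dissipation_eq0 (x : 'cV[R]_n) (y : 'cV[R]_p) :
  dissipation x y = 0 ->
  (forall i, x i ord0 = y (chi i) ord0 / gs (chi i)) /\
  (forall j k, y j ord0 = y k ord0).
Proof.
move=> Q0; split => [i|j k]; apply/eqP;
  rewrite -subr_eq0 -sqrf_eq0 eq_le sqr_ge0 andbT.
  by rewrite -Q0; exact: group_defect_le_dissipation.
have [C _ /(_ (x, y) I)] := difference_dominated setT j k.
by rewrite /= Q0 mulr0.
Qed.

(** A state of zero velocity has zero dissipation by [energy_balance]. *)
Lemma equilibriaE : equilibria R chi tail head =
  [set z : 'cV[R]_n * 'cV[R]_p |
    (forall i : 'I_n,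
       z.1 i ord0 = z.2 (chi i) ord0 / (group_size chi (chi i))%:R) /\
    (forall j k : 'I_p, z.2 j ord0 = z.2 k ord0)].
Proof.
apply/seteqP; split=> -[x y] /= [].
  move=> fx0 fy0; apply: dissipation_eq0; apply: oppr_inj.
  rewrite -energy_balance fx0 fy0 oppr0.
  by rewrite !big1 ?addr0// => i _; rewrite mxE mulr0.
move=> xy yy; split; apply/colP => i; rewrite [RHS]mxE.
  by rewrite field_xE xy addNr.
rewrite field_yE /laplacian_mx -mulmxA (_ : AG^T *m y = 0); last first.
  by apply/colP => e; rewrite incidence_trE mxE (yy _ (head e)) subrr.
rewrite mulmx0 mxE subr0.
rewrite (eq_bigr (fun=> y i ord0 / gs i)) => [|k]; last first.
  by rewrite inE => /eqP <-; exact: xy.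
by rewrite sumr_const -[_ *+ _]mulr_natr divfK ?subrr ?group_size_neq0.
Qed.

Hypothesis p_gt0 : (0 < p)%N.

Lemma equilibria_line : is_line (equilibria R chi tail head).
Proof.
pose v : 'cV[R]_n * 'cV[R]_p :=
  (\col_i (gs (chi i))^-1, const_mx 1).
exists 0, v; split.
  apply/eqP => -[_] /colP /(_ (Ordinal p_gt0)); rewrite !mxE.
  exact/eqP/oner_neq0.
rewrite equilibriaE; apply/seteqP; split=> [[x y] /= [xy yy]|_ [c _ <-] /=].
  exists (y (Ordinal p_gt0) ord0) => //; rewrite add0r.
  congr pair; apply/colP => i; rewrite !mxE.
    by rewrite xy (yy _ (Ordinal p_gt0)).
  by rewrite (yy i (Ordinal p_gt0)) /GRing.scale/= mulr1.
split=> [i|j k]; rewrite !mxE !add0r//.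
by rewrite mulr1.
Qed.

(** Since the shares [y_chi(i) / n_chi(i)] add up to [\sum_j y_j], a state of
    total zero satisfies [\sum_i defect_i + 2 \sum_j y_j = 0].  Hence
    [2 p y_k = 2 \sum_j (y_k - y_j) - \sum_i defect_i]. *)
Lemma coordinate_y_dominated (k : 'I_p) :
  dominated [set z | total z.1 z.2 = 0] dissipation2
    (fun z => z.2 k ord0 ^+ 2).
Proof.
apply: (dominated_le (g := fun z : state =>
  (\sum_j p%:R^-1 * (z.2 k ord0 - z.2 j ord0) +
   \sum_i (- (2 * p%:R)^-1) * group_defect z.1 z.2 i) ^+ 2)); last first.
  apply: dominated_sqrD; apply: dominated_sqr_sum => j; apply: dominated_sqrZ.
    exact: difference_dominated.
  by exists 1 => // z _; rewrite mul1r group_defect_le_dissipation.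
move=> z /= t0; rewrite le_eqVlt; apply/orP; left; apply/eqP; congr (_ ^+ 2).
rewrite -!mulr_sumr sumrB sumr_const card_ord.
rewrite /group_defect sumrB (sum_group_average (fun j => z.2 j ord0)).
move: t0; rewrite /total -mulr_natl => /eqP; rewrite addr_eq0 => /eqP ->.
have p0 : p%:R != 0 :> R by rewrite pnatr_eq0 -lt0n.
by field.
Qed.

Lemma coordinate_x_dominated (i : 'I_n) :
  dominated [set z | total z.1 z.2 = 0] dissipation2
    (fun z => z.1 i ord0 ^+ 2).
Proof.
apply: (dominated_le (g := fun z : state =>
  (group_defect z.1 z.2 i + (gs (chi i))^-1 * z.2 (chi i) ord0) ^+ 2)).
  by move=> z _; rewrite /group_defect [_^-1 * _]mulrC subrK.
apply: dominated_sqrD; last exact/dominated_sqrZ/coordinate_y_dominated.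
by exists 1 => // z _; rewrite mul1r group_defect_le_dissipation.
Qed.

(** Poincare inequality: zero is a simple eigenvalue of the symmetrized system,
    so the dissipation is coercive on the states of total zero, which form the
    complement of its eigenvector for the weighted inner product. *)
Lemma energy_gap : exists2 C : R, 0 < C &
  forall x y, total x y = 0 -> energy x y <= C * dissipation x y.
Proof.
have [C C0 xC] := dominated_sum
  (fun i => ltW (group_size_gt0 (chi i))) coordinate_x_dominated.
have [E E0 yE] := dominated_sum (fun=> ler01) coordinate_y_dominated.
(* The summand 1 only serves to make the constant positive. *)
exists (C + E + 1) => [|x y xy0]; first by rewrite ltr_wpDl ?addr_ge0.
have := xC (x, y) xy0; have := yE (x, y) xy0; rewrite /energy /=.
under eq_bigr do rewrite mul1r.
have := dissipation_ge0 x y; nra.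
Qed.

(** * Solutions *)

Lemma continuous_coord_within (m : nat) (A : set R) (z : R -> 'cV[R]_m)
    (i : 'I_m) :
  {within A, continuous z} -> {within A, continuous (fun t => z t i ord0)}.
Proof.
move=> cz t; have := @coord_continuous R m 1 i ord0 (z t).
exact: (@cvg_comp _ _ _ z (fun v : 'cV[R]_m => v i ord0) _ _ _ (cz t)).
Qed.

Lemma solution_total (x : R -> 'cV[R]_n) (y : R -> 'cV[R]_p) (t : R) :
  is_solution chi tail head x y -> 0 <= t ->
  total (x t) (y t) = total (x 0) (y 0).
Proof.
move=> [cx cy xy].
apply: (@is_derive0_constant _ (fun s => total (x s) (y s))) => [s|s s0].
  apply: cvgD; apply: cvg_big => [|i _]; try exact: add_continuous.
    exact: continuous_coord_within.
  exact: continuous_coord_within.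
have [/is_derive_cV dx /is_derive_cV dy] := xy s s0.
rewrite -(total_field (x s) (y s)).
apply: (is_deriveD (is_derive_sum_fun dx) (is_derive_sum_fun dy)).
Qed.

Lemma solution_energy_derive (x : R -> 'cV[R]_n) (y : R -> 'cV[R]_p) (t : R) :
  is_solution chi tail head x y -> 0 < t ->
  is_derive t 1 (fun s => energy (x s) (y s)) (- (2 * dissipation (x t) (y t))).
Proof.
move=> [cx cy xy] t0; have [/is_derive_cV dx /is_derive_cV dy] := xy t t0.
have Ex := is_derive_weighted_sqr (fun i => gs (chi i)) dx.
have Ey := is_derive_weighted_sqr (fun=> 1) dy.
rewrite -mulrN -energy_balance mulrDr.
rewrite (_ : (fun s => _) =
    (fun s => \sum_i gs (chi i) * x s i ord0 ^+ 2) +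
    (fun s => \sum_j 1 * y s j ord0 ^+ 2)); last first.
  apply/funext => s; rewrite /energy /GRing.add/=; congr (_ + _).
  by apply: eq_bigr => j _; rewrite mul1r.
apply: is_derive_eq; congr (_ + 2 * _).
by apply: eq_bigr => j _; rewrite mul1r.
Qed.

Lemma energy_continuous (x : R -> 'cV[R]_n) (y : R -> 'cV[R]_p) :
  is_solution chi tail head x y ->
  {within `[0, +oo[, continuous (fun s => energy (x s) (y s))}.
Proof.
move=> [cx cy _] s.
apply: cvgD; apply: cvg_big => [|i _]; try exact: add_continuous.
  apply: cvgMr; apply: cvgM; exact: continuous_coord_within.
apply: cvgM; exact: continuous_coord_within.
Qed.

(** Groups have at least one agent, so every weight in the energy is at least 1
    and each coordinate is bounded by the square root of the energy. *)
Lemma norm_le_energy (x : 'cV[R]_n) (y : 'cV[R]_p) :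
  `|(x, y)| <= Num.sqrt (energy x y).
Proof.
have x_ge0 : 0 <= \sum_i gs (chi i) * x i ord0 ^+ 2.
  apply: sumr_ge0 => i _.
  by rewrite mulr_ge0 ?sqr_ge0// ltW ?group_size_gt0.
have y_ge0 : 0 <= \sum_j y j ord0 ^+ 2.
  by apply: sumr_ge0 => j _; rewrite sqr_ge0.
rewrite prod_normE/= ge_max; apply/andP; split.
  rewrite [leLHS]/Num.Def.normr/= mx_normrE; apply: bigmax_le => // -[i j] _.
  rewrite (ord1 j)/= -sqrtr_sqr ler_sqrt ?addr_ge0// /energy (bigD1 i)//=.
  rewrite -!addrA; apply: (@le_trans _ _ (gs (chi i) * x i ord0 ^+ 2)).
    by rewrite ler_peMl ?sqr_ge0 ?group_size_ge1.
  rewrite lerDl addr_ge0// sumr_ge0// => k _.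
  by rewrite mulr_ge0 ?sqr_ge0// ltW ?group_size_gt0.
rewrite [leLHS]/Num.Def.normr/= mx_normrE; apply: bigmax_le => // -[i j] _.
rewrite (ord1 j)/= -sqrtr_sqr ler_sqrt ?addr_ge0// /energy.
rewrite [X in _ + X](bigD1 i)//= addrCA lerDl addr_ge0// sumr_ge0// => k _.
by rewrite sqr_ge0.
Qed.

(** Conservation keeps the total at zero, so [energy_gap] applies at all times
    and bounds the logarithmic derivative of the energy by [- 2 / C].  The norm
    decays at half this rate. *)
Lemma zero_total_decay (x : R -> 'cV[R]_n) (y : R -> 'cV[R]_p) :
  is_solution chi tail head x y -> total (x 0) (y 0) = 0 ->
  exists M lambda : R, 0 < lambda /\
    forall t : R, 0 <= t -> `|(x t, y t)| <= M * expR (- (lambda * t)).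
Proof.
move=> xy tot0; have [C C0 gap] := energy_gap.
exists (Num.sqrt (energy (x 0) (y 0))), C^-1; split; first by rewrite invr_gt0.
move=> t t0; apply: (le_trans (norm_le_energy _ _)).
have decay := expR_decay (k := 2 * C^-1) (energy_continuous xy)
  (fun s => solution_energy_derive xy).
have e0 : 0 <= energy (x 0) (y 0).
  rewrite addr_ge0// sumr_ge0// => i _; rewrite ?sqr_ge0//.
  by rewrite mulr_ge0 ?sqr_ge0// ltW ?group_size_gt0.
rewrite -[expR _]ger0_norm ?expR_ge0// -sqrtr_sqr -sqrtrM//.
apply: ler_wsqrtr; rewrite -expRM_natl mulrN mulrA.
apply: decay => // s s0; rewrite mulNr lerN2 -mulrA ler_pM2l//.
by rewrite ler_pdivrMl// gap// (solution_total xy (ltW s0)).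
Qed.

Lemma field_xB (x x' : 'cV[R]_n) (y y' : 'cV[R]_p) :
  field_x chi (x - x') (y - y') = field_x chi x y - field_x chi x' y'.
Proof. by rewrite /field_x mulmxBr opprD opprD !opprK addrACA. Qed.

Lemma field_yB (x x' : 'cV[R]_n) (y y' : 'cV[R]_p) :
  field_y chi tail head (x - x') (y - y') =
  field_y chi tail head x y - field_y chi tail head x' y'.
Proof.
by rewrite /field_y !mulmxBr opprD [in RHS]opprD addrACA.
Qed.

Lemma solutionB_equilibrium (x : R -> 'cV[R]_n) (y : R -> 'cV[R]_p) a b :
  is_solution chi tail head x y -> equilibria R chi tail head (a, b) ->
  is_solution chi tail head (fun t => x t - a) (fun t => y t - b).
Proof.
move=> [cx cy xy] [/= fa fb]; split=> [s|s|t t0].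
- apply: cvgB; [exact: cx | exact: cvg_cst].
- apply: cvgB; [exact: cy | exact: cvg_cst].
- have [dx dy] := xy t t0.
  rewrite field_xB field_yB fa fb; split.
    exact: (is_deriveB dx (is_derive_cst a t 1)).
  exact: (is_deriveB dy (is_derive_cst b t 1)).
Qed.

Lemma limit_equilibrium (x0 : 'cV[R]_n) (y0 : 'cV[R]_p) :
  equilibria R chi tail head (limit_x chi x0 y0, limit_y x0 y0).
Proof. by rewrite equilibriaE; split=> [i|j k] /=; rewrite !mxE. Qed.

(** The limit carries half of the total on the groups and half on the agents;
    this is where the factor [1 / (2 p)] comes from. *)
Lemma limit_total (x0 : 'cV[R]_n) (y0 : 'cV[R]_p) :
  total (limit_x chi x0 y0) (limit_y x0 y0) = total x0 y0.
Proof.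
rewrite /total.
under eq_bigr do rewrite mxE.
rewrite (sum_group_average (fun j => limit_y x0 y0 j ord0)).
under eq_bigr do rewrite mxE.
rewrite sumr_const card_ord -mulr_natr.
have p0 : p%:R != 0 :> R by rewrite pnatr_eq0 -lt0n.
by field.
Qed.

Lemma totalB (x x' : 'cV[R]_n) (y y' : 'cV[R]_p) :
  total (x - x') (y - y') = total x y - total x' y'.
Proof.
rewrite /total.
under eq_bigr do rewrite !mxE.
under [X in _ + X]eq_bigr do rewrite !mxE.
by rewrite !sumrB; ring.
Qed.

Lemma solution_cvg (x : R -> 'cV[R]_n) (y : R -> 'cV[R]_p) :
  is_solution chi tail head x y ->
  cvg_exponentially (fun t => (x t, y t))
    (limit_x chi (x 0) (y 0), limit_y (x 0) (y 0)).
Proof.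
move=> xy; have sol := solutionB_equilibrium xy (limit_equilibrium (x 0) (y 0)).
by apply: (zero_total_decay sol); rewrite totalB limit_total subrr.
Qed.

(** The block matrix of the system, applied to [col_mx x y], stacks the two
    vector fields. *)
Lemma solution_exists (x0 : 'cV[R]_n) (y0 : 'cV[R]_p) :
  exists (x : R -> 'cV[R]_n) (y : R -> 'cV[R]_p),
    [/\ is_solution chi tail head x y, x 0 = x0 & y 0 = y0].
Proof.
pose M : 'M[R]_(n + p) :=
  block_mx (- 1%:M) (AH *m invmx (AH^T *m AH))
           AH^T (- (1%:M + laplacian_mx R tail head)).
have [z [z0 dz]] := linear_equation_solution M (col_mx x0 y0).
have dzi (t : R) i : is_derive t 1 (fun s => z s i ord0) ((M *m z t) i ord0).
  exact: (is_derive_cV _ _ _).1.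
have Mz t : M *m z t = col_mx (field_x chi (usubmx (z t)) (dsubmx (z t)))
    (field_y chi tail head (usubmx (z t)) (dsubmx (z t))).
  rewrite -{1}[z t]vsubmxK mul_block_col /field_x /field_y.
  by rewrite mulNmx mul1mx mulNmx.
have dx (t : R) : is_derive t 1 (fun s => usubmx (z s))
    (field_x chi (usubmx (z t)) (dsubmx (z t))).
  apply/is_derive_cV => i; have := dzi t (lshift p i).
  rewrite Mz col_mxEu; congr (is_derive _ _ _ _).
  by apply/funext => s; rewrite mxE.
have dy (t : R) : is_derive t 1 (fun s => dsubmx (z s))
    (field_y chi tail head (usubmx (z t)) (dsubmx (z t))).
  apply/is_derive_cV => i; have := dzi t (rshift n i).
  rewrite Mz col_mxEd; congr (is_derive _ _ _ _).
  by apply/funext => s; rewrite mxE.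
exists (fun t => usubmx (z t)), (fun t => dsubmx (z t)).
split; [split=> // | by rewrite z0 col_mxKu | by rewrite z0 col_mxKd].
- apply: derivable_within_continuous => t _; by case: (dx t).
- apply: derivable_within_continuous => t _; by case: (dy t).
Qed.

End Network.

Theorem theorem2 (R : realType) (n p q : nat) (n_ge1 : (1 <= n)%N)
    (p_ge1 : (1 <= p)%N) (chi : 'I_n -> 'I_p)
    (group_nonempty : forall j : 'I_p, group chi j != finset.set0)
    (tail head : 'I_q -> 'I_p)
    (graph_simple : simple_graph tail head)
    (graph_connected : connected_graph tail head) :
  (equilibria R chi tail head =
     [set z : 'cV[R]_n * 'cV[R]_p |
        (forall i : 'I_n,
           z.1 i ord0 = z.2 (chi i) ord0 / (group_size chi (chi i))%:R) /\
        (forall j k : 'I_p, z.2 j ord0 = z.2 k ord0)] /\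
   is_line (equilibria R chi tail head)) /\
  (forall (x0 : 'cV[R]_n) (y0 : 'cV[R]_p),
     equilibria R chi tail head (limit_x chi x0 y0, limit_y x0 y0) /\
     (exists (x : R -> 'cV[R]_n) (y : R -> 'cV[R]_p),
        [/\ is_solution chi tail head x y, x 0 = x0 & y 0 = y0]) /\
     (forall (x : R -> 'cV[R]_n) (y : R -> 'cV[R]_p),
        is_solution chi tail head x y -> x 0 = x0 -> y 0 = y0 ->
        cvg_exponentially (fun t => (x t, y t))
                          (limit_x chi x0 y0, limit_y x0 y0))).
Proof.
have loopless := graph_simple.1.
split; first by split; [exact: equilibriaE | exact: equilibria_line].
move=> x0 y0; split; first exact: limit_equilibrium.
split; first exact: solution_exists.
by move=> x y xy <- <-; exact: solution_cvg.
Qed.
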